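(* Let $X$ be a completely regular topological space. Then $X$ is countably compact if and only if the topological uniform metastability principle holds for $X$, i.e. if and only if for every closed subspace $C\subseteq X$ and every sequence $\langle f_n : n<\omega\rangle$ of continuous functions $f_n : X\to\mathbb{R}$ such that $\langle f_n(x) : n<\omega\rangle$ converges in $\mathbb{R}$ for each $x\in C$, the sequence $\langle f_n : n<\omega\rangle$ is uniformly metastable on $C$.
   Context: Completely regular means: for every closed $F\subseteq X$ and every $x\in X\setminus F$ there is a continuous $g:X\to[0,1]$ with $g(x)=0$ and $g(y)=1$ for all $y\in F$ (no $T_1$ or Hausdorff assumption is made). Countably compact means: every countable open cover has a finite subcover. A sampling of $\omega$ is a family $\eta=\{\eta_n : n<\omega\}$ of finite subsets of $\omega$ such that $\eta_n\subseteq\{k\in\omega : k\ge n\}$ for each $n<\omega$. Let $\mathcal{S}$ denote the set of all samplings of $\omega$. A sequence $\langle f_n : n<\omega\rangle$ of real-valued functions is uniformly metastable on a set $C$ contained in their common domain if there is a family of natural numbers $\{E_{\varepsilon,\eta} : \varepsilon>0,\ \eta\in\mathcal{S}\}$ such that for every $\varepsilon>0$, every $\eta\in\mathcal{S}$ and every $x\in C$ there is $m<E_{\varepsilon,\eta}$ with $|f_i(x)-f_j(x)|<\varepsilon$ for all $i,j\in\eta_m$. (The bound $E_{\varepsilon,\eta}$ does not depend on $x$, but $m$ may depend on $x$.) *)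

(* Defs.v *)
From HB Require Import structures.
From mathcomp Require Import all_boot all_order all_algebra.
From mathcomp Require Import all_classical all_reals all_analysis.

Set Implicit Arguments.
Unset Strict Implicit.
Unset Printing Implicit Defensive.

Import Order.TTheory GRing.Theory Num.Theory.
Import numFieldNormedType.Exports.

Local Open Scope classical_set_scope.
Local Open Scope ring_scope.

(* The library's [completely_regular_space] is phrased with uniform separators;
   this is the functional definition. No T1 or Hausdorff condition. *)
Definition completely_regular (R : realType) (X : topologicalType) : Prop :=
  forall (F : set X) (x : X), closed F -> ~ F x ->
  exists g : X -> R, [/\ continuous g,
    forall y, g y \in `[0, 1],
    g x = 0 &
    forall y, F y -> g y = 1].

Definition countably_compact (X : topologicalType) : Prop :=
  forall U : set (set X), countable U -> U `<=` open ->
  \bigcup_(A in U) A = [set: X] ->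
  exists V : set (set X), [/\ V `<=` U, finite_set V &
    \bigcup_(A in V) A = [set: X]].

Definition sampling : set (nat -> set nat) :=
  [set eta | forall n, finite_set (eta n) /\ eta n `<=` [set k | (n <= k)%N]].

(* The bound [E] is a total function, but only its values at [eps > 0] and at
   samplings are constrained. *)
Definition uniformly_metastable (R : realType) (X : Type)
    (f : nat -> X -> R) (C : set X) : Prop :=
  exists E : R -> (nat -> set nat) -> nat,
  forall (eps : R) (eta : nat -> set nat) (x : X),
  0 < eps -> sampling eta -> C x ->
  exists2 m, (m < E eps eta)%N &
    forall i j, eta m i -> eta m j -> `|f i x - f j x| < eps.

Definition topological_uniform_metastability_principle
    (R : realType) (X : topologicalType) : Prop :=
  forall (C : set X) (f : nat -> X -> R),
  closed C ->
  (forall n, continuous (f n)) ->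
  (forall x, C x -> cvgn (fun n => f n x)) ->
  uniformly_metastable f C.

(* Main.v *)
Require Import Defs.
From mathcomp Require Import all_boot all_order all_algebra.
From mathcomp Require Import all_classical all_reals all_analysis.

Import Order.TTheory GRing.Theory Num.Theory.
Import numFieldNormedType.Exports.

Local Open Scope classical_set_scope.
Local Open Scope ring_scope.

(** Countable compactness says that a nondecreasing open cover [V 0, V 1, ...]
    is eventually the whole space.

    If [X] is countably compact, fix [eps] and [eta], and let [U m] be the set
    of points at which [f] moves by less than [eps] on [eta m].  It is open
    because [eta m] is finite, and pointwise convergence on [C] makes the
    [U m] cover [C]: the tail of a Cauchy sequence contains [eta m] for large
    [m].  The nondecreasing open cover [~` C `|` \bigcup_(m < n) U m] is
    eventually all of [X], and the index at which this happens is a bound that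
    serves every point of [C].

    If [X] is not countably compact, some nondecreasing open cover [W] has
    points [p k] in [W k.+1] but outside [W k].  Complete regularity gives
    continuous [g k] vanishing at [p k] and equal to 1 off [W k.+1], hence at
    every later point [p j].  The product [g 0 * ... * g n] therefore vanishes
    at [p k] as soon as [k <= n] and is 1 there before, so
    [f n = (n mod 2) * g 0 * ... * g n] alternates between 0 and 1 at [p k]
    during the first [k] steps and stays at 0 afterwards.  A merely monotone
    switch from 1 to 0 would be uniformly metastable; alternation is what
    defeats every uniform bound, for the sampling [eta m = {m, m + 1}] and
    [eps = 1].  Convergence is needed on a closed set.  The closure of all the
    [p k] works: a point [y] of it lies in some open [W m], which contains only
    the points [p k] with [k < m], so the continuous functions [f n], which for
    [n >= m] vanish at all of these, also vanish at [y]. *)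

Section NondecreasingCovers.
Context {X : Type} (V : nat -> set X).
Hypothesis V_nondecreasing : {homo V : m n / (m <= n)%N >-> m `<=` n}.

Lemma finite_subfamily_nondecreasing (B : set (set X)) :
  finite_set B -> B `<=` range V -> exists n, \bigcup_(A in B) A `<=` V n.
Proof.
move=> /finite_seqP[s ->]; elim: s => [|A s IHs] sV.
  by exists 0%N => x [].
have [|n sVn] := IHs.
  by move=> D Ds; apply: sV; rewrite /= in_cons Ds orbT.
have [m _ VmA] : range V A by apply: sV; rewrite /= mem_head.
exists (maxn m n) => x [D /=]; rewrite in_cons => /predU1P[->|Ds] Dx.
  by apply: (V_nondecreasing _ _ (leq_maxl m n)); rewrite VmA.
by apply: (V_nondecreasing _ _ (leq_maxr m n)); apply: sVn; exists D.
Qed.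

(** Thinning out a cover so that a point escapes at each step: an escaping
    point lies in some later member of the cover, from which the next point is
    chosen to escape. *)
Lemma escaping_points :
  \bigcup_n V n = [set: X] -> (forall n, V n <> [set: X]) ->
  exists N : nat -> nat, exists p : nat -> X,
    [/\ {homo N : m n / (m <= n)%N}, \bigcup_k V (N k) = [set: X],
        forall k, ~ V (N k) (p k) & forall k, V (N k.+1) (p k)].
Proof.
move=> Vcov Vproper.
have /choice[pq pqP] n : exists xm : X * nat, ~ V n xm.1 /\ V xm.2 xm.1.
  have [x Vnx] : exists x, ~ V n x.
    by apply/existsNP => VT; apply: (Vproper n); apply/seteqP; split.
  by have [m _ Vmx] : (\bigcup_n V n) x by [rewrite Vcov]; exists (x, m).
have pq_gt n : (n < (pq n).2)%N.
  rewrite ltnNge; apply/negP => /V_nondecreasing sub.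
  by have [nVn /sub] := pqP n.
pose N k := iter k (fun n => (pq n).2) 0%N.
have N_ge k : (k <= N k)%N.
  by elim: k => //= k IHk; apply: leq_ltn_trans IHk (pq_gt _).
exists N, (fun k => (pq (N k)).1); split.
- by apply: homo_leq => // [|k]; [exact: leq_trans|exact: ltnW (pq_gt _)].
- apply/seteqP; split=> // x _.
  have [k _ Vkx] : (\bigcup_n V n) x by rewrite Vcov.
  by exists k => //; apply: (V_nondecreasing _ _ (N_ge k)).
- by move=> k; have [] := pqP (N k).
- by move=> k; have [] := pqP (N k).
Qed.

End NondecreasingCovers.

(** Passing to the unions of the initial segments of an enumeration turns an
    arbitrary countable cover into a nondecreasing one. *)
Lemma countably_compact_nondecreasingP (X : topologicalType) :
  countably_compact X <->
  forall V : nat -> set X, (forall n, open (V n)) ->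
    {homo V : m n / (m <= n)%N >-> m `<=` n} ->
    \bigcup_n V n = [set: X] -> exists n, V n = [set: X].
Proof.
split=> [ccX V Vopen Vnd Vcov|Vstat U Ucount Uopen Ucov].
  have [|||B [BV Bfin Bcov]] := ccX (range V).
  - exact: card_image_le.
  - by move=> _ [n _ <-].
  - by rewrite bigcup_image.
  have [n sVn] := finite_subfamily_nondecreasing V Vnd B Bfin BV.
  by exists n; apply/seteqP; split=> // x _; apply: sVn; rewrite Bcov.
have /countable_injP[i iinj] := Ucount.
pose B n := [set A | U A /\ (i A < n)%N].
have [n|||n Vn] := Vstat (fun n => \bigcup_(A in B n) A).
- by apply: bigcup_open => A [/Uopen].
- move=> m n mn x [A [UA Am] Ax]; exists A => //; split=> //.
  exact: leq_trans mn.
- apply/seteqP; split=> // x _.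
  have [A UA Ax] : (\bigcup_(A in U) A) x by rewrite Ucov.
  by exists (i A).+1 => //; exists A => //; split.
exists (B n); split=> // [A []//|].
have iB : {in B n &, injective i}.
  by move=> A D /set_mem[UA _] /set_mem[UD _]; apply: iinj; rewrite inE.
rewrite -(eq_finite_set (inj_card_eq iB)).
by apply: sub_finite_set (finite_II n) => _ [A [_ An] <-].
Qed.

Section CountablyCompact.
Context {R : realType} {X : topologicalType}.
Implicit Types (f : nat -> X -> R) (C : set X).

Lemma open_small_oscillation f (S : set nat) (eps : R) :
  finite_set S -> (forall n, continuous (f n)) ->
  open [set x | forall i j, S i -> S j -> `|f i x - f j x| < eps].
Proof.
move=> Sfin fcont.
rewrite (_ : [set x | _] = ~` \bigcup_(ij in S `*` S)
    [set x | eps <= `|f ij.1 x - f ij.2 x|]); last first.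
  apply/seteqP; split=> [x fx [[i j] [/= Si Sj]]|x fx i j Si Sj].
    by rewrite leNgt fx.
  by rewrite ltNge; apply/negP => le; apply: fx; exists (i, j).
apply: closed_openC; apply: closed_bigcup; first exact: finite_setX.
move=> ij _.
apply: (@closed_comp _ _ (fun x => `|f ij.1 x - f ij.2 x|) [set y | eps <= y]).
  move=> x _; apply: cvg_norm; apply: cvgB; exact: fcont.
exact: closed_ge.
Qed.

Lemma cvgn_small_oscillation (u : nat -> R) (eps : R) :
  cvgn u -> 0 < eps ->
  exists N, forall i j, (N <= i)%N -> (N <= j)%N -> `|u i - u j| < eps.
Proof.
move=> /cvg_ex[l ul] eps0.
have [N _ NP] : \forall n \near \oo, `|l - u n| < eps / 2.
  by move/cvgrPdist_lt: ul; apply; rewrite divr_gt0.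
exists N => i j Ni Nj; rewrite (le_lt_trans (ler_distD l _ _))//.
rewrite [ltRHS]splitr ltrD//; [rewrite distrC|]; exact: NP.
Qed.

(** The sets of small oscillation on the [eta m], together with the complement
    of [C], cover [X]; the bound is the length of an initial segment that
    already covers. *)
Lemma countably_compact_metastable_bound {f C} {eps : R} {eta} :
  countably_compact X -> closed C -> (forall n, continuous (f n)) ->
  (forall x, C x -> cvgn (fun n => f n x)) -> 0 < eps -> sampling eta ->
  exists E, forall x, C x -> exists2 m, (m < E)%N &
    forall i j, eta m i -> eta m j -> `|f i x - f j x| < eps.
Proof.
move=> /countably_compact_nondecreasingP ccX Ccl fcont fcvg eps0 etaS.
pose U m := [set x | forall i j, eta m i -> eta m j -> `|f i x - f j x| < eps].
have [n|||E VE] := ccX (fun n => ~` C `|` \bigcup_(m in `I_n) U m).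
- apply: openU; first exact: closed_openC.
  by apply: bigcup_open => m _; apply: open_small_oscillation; have [] := etaS m.
- move=> m n mn; apply: setUS; apply: bigcup_sub => k km.
  by apply: bigcup_sup => /=; apply: leq_trans mn.
- apply/seteqP; split=> // x _.
  have [/fcvg fx|nCx] := pselect (C x); last by exists 0%N => //; left.
  have [N NP] := cvgn_small_oscillation _ _ fx eps0.
  exists N.+1 => //; right; exists N => //= i j.
  by have [_ sub] := etaS N; move=> /sub/= Ni /sub/= Nj; exact: NP.
exists E => x Cx.
have [//|[m /= mE Umx]] : (~` C `|` \bigcup_(m in `I_E) U m) x by rewrite VE.
by exists m.
Qed.

Lemma countably_compact_metastability :
  countably_compact X -> topological_uniform_metastability_principle R X.
Proof.
move=> ccX C f Ccl fcont fcvg.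
have /choice[E EP] (ee : R * (nat -> set nat)) : exists E, forall x,
    0 < ee.1 -> sampling ee.2 -> C x -> exists2 m, (m < E)%N &
    forall i j, ee.2 m i -> ee.2 m j -> `|f i x - f j x| < ee.1.
  have [eps0|neps] := pselect (0 < ee.1); last by exists 0%N => x /neps.
  have [etaS|neta] := pselect (sampling ee.2); last by exists 0%N => x _ /neta.
  have [E EP] := countably_compact_metastable_bound ccX Ccl fcont fcvg eps0 etaS.
  by exists E => x _ _; exact: EP.
by exists (fun eps eta => E (eps, eta)) => eps eta x; exact: (EP (eps, eta)).
Qed.

End CountablyCompact.

Section EscapingPoints.
Context {R : realType} {X : topologicalType}.
Context (W : nat -> set X) (p : nat -> X).
Hypothesis W_open : forall k, open (W k).
Hypothesis W_nondecreasing : {homo W : m n / (m <= n)%N >-> m `<=` n}.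
Hypothesis W_cover : \bigcup_k W k = [set: X].
Hypothesis p_notin : forall k, ~ W k (p k).
Hypothesis p_in : forall k, W k.+1 (p k).

Lemma escaping_separators : completely_regular R X ->
  exists g : nat -> X -> R, [/\ forall k, continuous (g k),
    forall k, g k (p k) = 0 & forall k j, (k < j)%N -> g k (p j) = 1].
Proof.
move=> crX.
have /choice[g gP] k : exists g : X -> R, [/\ continuous g, g (p k) = 0 &
    forall y, ~ W k.+1 y -> g y = 1].
  have [||g [gcont _ g0 g1]] := crX (~` W k.+1) (p k).
  - exact: open_closedC.
  - exact.
  by exists g.
exists g; split=> [k|k|k j kj]; have [gcont g0 g1] := gP k => //.
by apply: g1 => /(W_nondecreasing _ _ kj)/p_notin.
Qed.

(** The factor [g k] enters the product at time [k] and annihilates it at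
    [p k], while the earlier factors are 1 there and leave only the parity. *)
Lemma alternating_functions : completely_regular R X ->
  exists f : nat -> X -> R, [/\ forall n, continuous (f n),
    forall n k, (k <= n)%N -> f n (p k) = 0 &
    forall n k, (n < k)%N -> f n (p k) = (odd n)%:R].
Proof.
move=> /escaping_separators[g [gcont g0 g1]].
exists (fun n x => (odd n)%:R * \prod_(k < n.+1) g k x).
split=> [n x|n k kn|n k nk].
- apply: cvgM; first exact: cvg_cst.
  apply: (@continuous_big R _ *%R) => [|k _]; [exact: mul_continuous|exact: gcont].
- by rewrite (bigD1 (Ordinal (kn : (k < n.+1)%N)))//= g0 mul0r mulr0.
- rewrite big1 ?mulr1// => i _; apply: g1.
  by apply: leq_ltn_trans nk; rewrite -ltnS.
Qed.

(** A point of the closure has an open neighborhood [W m], which meets only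
    finitely many of the [p k]; where a continuous function does not vanish is
    open, so it must contain one of these as soon as it contains the point. *)
Lemma closure_escaping_vanish (f : nat -> X -> R) :
  (forall n, continuous (f n)) ->
  (forall n k, (k <= n)%N -> f n (p k) = 0) ->
  forall y, closure (range p) y -> exists m, forall n, (m <= n)%N -> f n y = 0.
Proof.
move=> fcont f0 y yC.
have [m _ Wmy] : (\bigcup_k W k) y by rewrite W_cover.
exists m => n mn; apply: contrapT => /eqP fny.
have Ny : nbhs y (W m `&` f n @^-1` [set z | z != 0]).
  apply: filterI; first exact: open_nbhs_nbhs.
  by apply: fcont; apply: open_nbhs_nbhs; split=> //; exact: open_neq.
have [_ [[k _ <-] [Wmk /=]]] := yC _ Ny.
rewrite f0 ?eqxx// (leq_trans _ mn)// leqNgt; apply/negP => mk.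
by apply: (p_notin k); apply: W_nondecreasing Wmk; exact: ltnW.
Qed.

Lemma escaping_not_metastable : completely_regular R X ->
  ~ topological_uniform_metastability_principle R X.
Proof.
move=> /alternating_functions[f [fcont f0 falt]] /(_ (closure (range p)) f).
case=> // [|y /(closure_escaping_vanish f fcont f0)[m fm]|E EP].
- exact: closed_closure.
- apply/cvg_ex; exists 0; apply: cvg_near_cst.
  by exists m.
pose eta m := [set m; m.+1].
have etaS : sampling eta.
  move=> n; split; first exact: finite_set2.
  by move=> k [->|->] /=.
(* The index leaves room for [m.+1] below it whenever [m] is within the bound. *)
pose x := p (E 1 eta).+1.
have Cx : closure (range p) x by apply: subset_closure; exists (E 1 eta).+1.
have [m mE] := EP 1 eta x ltr01 etaS Cx.
move=> /(_ m m.+1 (or_introl erefl) (or_intror erefl)).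
rewrite /x !falt ?ltnS//; last exact: ltnW.
by rewrite oddS; case: (odd m); rewrite ?mulr0n ?mulr1n ?subr0
  ?sub0r ?normrN normr1 ltxx.
Qed.

End EscapingPoints.

Theorem theorem2p4 (R : realType) (X : topologicalType)
    (crX : completely_regular R X) :
  countably_compact X <-> topological_uniform_metastability_principle R X.
Proof.
split; first exact: countably_compact_metastability.
move=> metaX; apply/countably_compact_nondecreasingP => V Vopen Vnd Vcov.
apply: contrapT => /forallNP Vproper.
have [N [p [Nnd Ncov pN pNS]]] := escaping_points V Vnd Vcov Vproper.
apply: (escaping_not_metastable (V \o N) p) crX metaX => // [k|m n mn].
  exact: Vopen.
exact/Vnd/Nnd.
Qed.
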